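(* Let $T:\mathbb{R}^n\to\mathbb{R}^n$ be the Shapley operator of a concurrent unichain game with $n$ states, let $\theta=p_{\min}/(1+p_{\min})$, let $T_\theta=\theta I+(1-\theta)T$ be the associated Krasnoselskii-Mann operator, and let $k_{\mathrm{uni}}$ be the unichain index of the game. Then $T_\theta^{k_{\mathrm{uni}}}$ is a contraction in Hilbert's seminorm, with rate bounded by $1-\theta^{k_{\mathrm{uni}}}$, that is, $$\|T_\theta^{k_{\mathrm{uni}}}(x)-T_\theta^{k_{\mathrm{uni}}}(y)\|_{\mathrm H}\le (1-\theta^{k_{\mathrm{uni}}})\,\|x-y\|_{\mathrm H}\qquad\text{for all }x,y\in\mathbb{R}^n .$$ Moreover, if the game is irreducible, with irreducibility index $k_{\mathrm{irr}}$, then $T_\theta^{k_{\mathrm{irr}}}$ is a contraction in Hilbert's seminorm with rate bounded by $1-n\theta^{k_{\mathrm{irr}}}$.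
   Context: Notation: $[n]=\{1,\dots,n\}$; Hilbert's seminorm on $\mathbb{R}^n$ is $\|x\|_{\mathrm H}=\max_{i}x_i-\min_i x_i$; $I$ is the identity. Concurrent game: the state space is $[n]$. For each state $i$ there are nonempty compact action sets $A(i)$ (player Min) and $B(i)$ (player Max), and for each $(a,b)\in A(i)\times B(i)$ a payment $r_i^{a,b}\in\mathbb{R}$ and a stochastic vector $P_i^{a,b}=(P_{ij}^{a,b})_{j\in[n]}$ (nonnegative entries summing to $1$), all depending continuously on $(a,b)$. Let $\Delta_{A(i)},\Delta_{B(i)}$ be the sets of probability measures on $A(i),B(i)$, and for $\alpha_i\in\Delta_{A(i)},\beta_i\in\Delta_{B(i)}$ put $r_i^{\alpha_i,\beta_i}=\int r_i^{a,b}\,d\alpha_i(a)d\beta_i(b)$, $P_{ij}^{\alpha_i,\beta_i}=\int P_{ij}^{a,b}\,d\alpha_i(a)d\beta_i(b)$. The Shapley operator $T:\mathbb{R}^n\to\mathbb{R}^n$ is $$T_i(v)=\min_{\alpha_i\in\Delta_{A(i)}}\max_{\beta_i\in\Delta_{B(i)}}\Big(r_i^{\alpha_i,\beta_i}+\sum_{j\in[n]}P_{ij}^{\alpha_i,\beta_i}v_j\Big).$$ Pure policies: a pure policy of Min (resp. Max) is a map $\sigma$ (resp. $\tau$) with $\sigma(i)\in A(i)$ (resp. $\tau(i)\in B(i)$) for all $i$. Set $P^{\sigma,\tau}=(P_{ij}^{\sigma(i),\tau(i)})_{i,j\in[n]}$. The digraph of a nonnegative $n\times n$ matrix $M$ has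 an arc $i\to j$ iff $M_{ij}>0$; $M$ is irreducible if this digraph is strongly connected, and unichain if it has a unique final strongly connected component (a component is final if any path starting in it stays in it). The game is unichain (resp. irreducible) if $P^{\sigma,\tau}$ is unichain (resp. irreducible) for all pairs of pure policies $(\sigma,\tau)$. $p_{\min}=\min\{P_{ij}^{a,b}: i\neq j,\ (a,b)\in A(i)\times B(i),\ P_{ij}^{a,b}>0\}$ (this minimum is presupposed to exist; this is a restriction only for infinite action sets or $n=1$). With $\theta=p_{\min}/(1+p_{\min})$, set $Q^{\sigma,\tau}=\theta I+(1-\theta)P^{\sigma,\tau}$. Unichain index $k_{\mathrm{uni}}$ of a unichain game: the smallest integer $k$ such that for all $i_1,i_2\in[n]$ and all sequences $(\sigma_1,\tau_1),\dots,(\sigma_k,\tau_k)$ of pairs of pure policies, there is $j$ with $[Q^{\sigma_1,\tau_1}\cdots Q^{\sigma_k,\tau_k}]_{i_1j}>0$ and $[Q^{\sigma_1,\tau_1}\cdots Q^{\sigma_k,\tau_k}]_{i_2j}>0$. Irreducibility index $k_{\mathrm{irr}}$ of an irreducible game: the smallest integer $k$ such that $Q^{\sigma_1,\tau_1}\cdots Q^{\sigma_k,\tau_k}$ has only positive entries for all such sequences. (Such integers exist and are at most $n$.) *)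

(* Defs.v *)
From HB Require Import structures.
From mathcomp Require Import all_boot all_order all_algebra.
From mathcomp Require Import all_classical all_reals all_analysis.
Set Implicit Arguments.
Unset Strict Implicit.
Unset Printing Implicit Defensive.
Import Order.TTheory GRing.Theory Num.Theory.
Import numFieldNormedType.Exports.
Local Open Scope classical_set_scope.
Local Open Scope ring_scope.

Definition is_minimum d (T : porderType d) (S : set T) (m : T) : Prop :=
  S m /\ lbound S m.

(* The range of x is finite, so for 0 < n the supremum and the infimum are
   the maximum and the minimum of the entries. *)
Definition hilbert_seminorm (R : realType) n (x : 'cV[R]_n) : R :=
  sup (range (fun i => x i ord0)) - inf (range (fun i => x i ord0)).

Definition arc (R : realType) n (M : 'M[R]_n) : rel 'I_n :=
  fun i j => 0 < M i j.

Definition irreducible_mx (R : realType) n (M : 'M[R]_n) : Prop :=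
  forall i j, connect (arc M) i j.

Definition strong_component (R : realType) n (M : 'M[R]_n)
    (C : {set 'I_n}) : Prop :=
  exists i, C = [set j | connect (arc M) i j && connect (arc M) j i]%SET.

Definition final_component (R : realType) n (M : 'M[R]_n)
    (C : {set 'I_n}) : Prop :=
  strong_component M C /\
  forall i j, i \in C -> connect (arc M) i j -> j \in C.

Definition unichain_mx (R : realType) n (M : 'M[R]_n) : Prop :=
  exists! C : {set 'I_n}, final_component M C.

(* Nonemptiness of the action spaces is carried by the base point of
   ptopologicalType. *)
Record concurrent_game (R : realType) (n : nat) := ConcurrentGame {
  act_min : 'I_n -> ptopologicalType;
  act_max : 'I_n -> ptopologicalType;
  act_min_compact : forall i, compact [set: act_min i];
  act_max_compact : forall i, compact [set: act_max i];
  payment : forall i, act_min i -> act_max i -> R;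
  transition : forall i, act_min i -> act_max i -> 'I_n -> R;
  payment_continuous : forall i,
    continuous (fun ab : act_min i * act_max i => payment ab.1 ab.2);
  transition_continuous : forall i j,
    continuous (fun ab : act_min i * act_max i => transition ab.1 ab.2 j);
  transition_ge0 : forall i (a : act_min i) (b : act_max i) j,
    0 <= transition a b j;
  transition_sum1 : forall i (a : act_min i) (b : act_max i),
    \sum_j transition a b j = 1
}.

Definition borel_prob (R : realType) (X : ptopologicalType) :=
  probability (g_sigma_algebraType (@open X)) R.

(* Iterated integral rather than an integral against the product measure: for
   f continuous on compact X * Y the two agree, and no comparison between the
   Borel sets of X * Y and the product sigma-algebra is needed. *)
Definition mixed_mean (R : realType) (X Y : ptopologicalType)
    (alpha : borel_prob R X) (beta : borel_prob R Y) (f : X -> Y -> R) : R :=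
  \int[beta]_b \int[alpha]_a f a b.

(* min and max over mixed actions are rendered by inf and sup; payments and
   transition probabilities being bounded, both are finite. *)
Definition shapley (R : realType) n (G : concurrent_game R n)
    (v : 'cV[R]_n) : 'cV[R]_n :=
  \col_i inf (range (fun alpha : borel_prob R (act_min G i) =>
           sup (range (fun beta : borel_prob R (act_max G i) =>
             mixed_mean alpha beta (@payment R n G i)
             + \sum_j mixed_mean alpha beta
                        (fun a b => @transition R n G i a b j) * v j ord0)))).

Definition km_operator (R : realType) n (theta : R)
    (T : 'cV[R]_n -> 'cV[R]_n) (x : 'cV[R]_n) : 'cV[R]_n :=
  theta *: x + (1 - theta) *: T x.

Definition policy_min (R : realType) n (G : concurrent_game R n) :=
  forall i, act_min G i.

Definition policy_max (R : realType) n (G : concurrent_game R n) :=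
  forall i, act_max G i.

Definition transition_mx (R : realType) n (G : concurrent_game R n)
    (sigma : policy_min G) (tau : policy_max G) : 'M[R]_n :=
  \matrix_(i, j) transition (sigma i) (tau i) j.

Definition unichain_game (R : realType) n (G : concurrent_game R n) : Prop :=
  forall (sigma : policy_min G) (tau : policy_max G),
    unichain_mx (transition_mx sigma tau).

Definition irreducible_game (R : realType) n (G : concurrent_game R n) : Prop :=
  forall (sigma : policy_min G) (tau : policy_max G),
    irreducible_mx (transition_mx sigma tau).

Definition offdiag_probs (R : realType) n (G : concurrent_game R n) : set R :=
  [set p | exists i j (a : act_min G i) (b : act_max G i),
     [/\ i != j, 0 < transition a b j & p = transition a b j]].

Definition lazy_mx (R : realType) n (G : concurrent_game R n) (theta : R)
    (st : policy_min G * policy_max G) : 'M[R]_n :=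
  theta%:M + (1 - theta) *: transition_mx st.1 st.2.

(* Ordered product Q_0 *m Q_1 *m ... *m Q_(k-1). *)
Definition lazy_prod (R : realType) n (G : concurrent_game R n) (theta : R)
    k (s : 'I_k -> policy_min G * policy_max G) : 'M[R]_n :=
  \big[mulmx/1%:M]_(l < k) lazy_mx theta (s l).

Definition is_unichain_index (R : realType) n (G : concurrent_game R n)
    (theta : R) (k : nat) : Prop :=
  is_minimum
    [set m : nat | forall (i1 i2 : 'I_n)
       (s : 'I_m -> policy_min G * policy_max G),
       exists j, 0 < lazy_prod theta s i1 j /\ 0 < lazy_prod theta s i2 j] k.

Definition is_irreducibility_index (R : realType) n (G : concurrent_game R n)
    (theta : R) (k : nat) : Prop :=
  is_minimum
    [set m : nat | forall (s : 'I_m -> policy_min G * policy_max G) i j,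
       0 < lazy_prod theta s i j] k.

(* Main.v *)
Require Import Defs.
From mathcomp Require Import all_boot all_order all_algebra.
From mathcomp Require Import all_classical all_reals all_analysis.
From mathcomp Require Import ring lra.
Import Order.TTheory GRing.Theory Num.Theory.
Import numFieldNormedType.Exports.
Local Open Scope classical_set_scope.
Local Open Scope ring_scope.
Set Implicit Arguments.
Unset Strict Implicit.
Unset Printing Implicit Defensive.

(** Write D_k for the difference of the k-th iterates of the Krasnoselskii-Mann
    operator at x and at y, so that D_0 = x - y. Everything rests on comparing
    D_k with products of pure transition matrices applied to x - y.

    One step, one state. An inf-sup is monotone in its payoff, so T_i x - T_i y
    is at most the supremum, over pairs of mixed actions, of the mean of
    P_i (x - y). That mean is at most the maximum of P_i^{a,b} (x - y) over
    pure actions, which is attained by compactness ([shapley_le_pure]).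
    Exchanging x and y gives a lower bound by a pure pair as well, in general a
    different one.

    One step, all states. Test the difference against a row vector u. At each
    state the sign of u_i tells which of the two bounds to use, so one pair of
    pure policies satisfies u (T x - T y) <= u P (x - y)
    ([shapley_le_policy]), and likewise for the lazy matrix Q. Replacing u by
    u Q and iterating gives a single sequence of policy pairs with
    u D_k <= u Q_1 ... Q_k (x - y) ([iter_km_le_lazy_prod]). Testing against a
    row vector is what makes this possible: for u = e_i1 - e_i2 the two
    entries of D_k that are compared are controlled by two rows of the same
    product, which is the situation the two indices speak about.

    Overlap of rows. By the choice of theta, each positive entry of Q is at
    least theta, hence each positive entry of a product of k such matrices is
    at least theta ^ k ([lazy_prod_gt0]). If two stochastic rows both dominate
    a vector of total mass gamma, their values on z differ by at most
    1 - gamma times the oscillation of z ([doeblin_bound]). The common positive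
    column provided by the unichain index gives gamma = theta ^ k; the n
    positive columns provided by the irreducibility index give
    gamma = n theta ^ k.

    The analytic part consists in showing that the iterated integral
    [mixed_mean] is linear, monotone and normalized on continuous functions.
    This requires the inner integral to be a measurable function of the outer
    variable; it is even continuous, by compactness
    ([continuous_inner_mean]). *)

(** * Means of continuous functions over compact spaces *)

Lemma continuous_borel_measurable (R : realType) (X : ptopologicalType)
    (f : X -> R) :
  continuous f ->
  measurable_fun setT (f : g_sigma_algebraType (@open X) -> R).
Proof.
move=> /continuousP cf.
apply: (measurability _ (measurable_realfun.RGenOpens.measurableE R)) => //.
move=> _ [_ [a [b ->] <-]]; rewrite setTI.
by apply: sub_sigma_algebra; exact/cf/interval_open.
Qed.

Lemma continuous_compact_bounded (R : realType) (X : topologicalType)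
    (f : X -> R) :
  compact [set: X] -> continuous f -> exists M, forall x, `|f x| <= M.
Proof.
move=> cX cf; have /compact_bounded[N [_ fN]] : compact (f @` [set: X]).
  by apply: continuous_compact => // x; exact/continuous_subspaceT.
exists (N + 1) => x; apply: (fN (N + 1)); first by rewrite ltrDl.
by exists x.
Qed.

Lemma bounded_probability_integrable (R : realType) (d : measure_display)
    (T : measurableType d) (P : probability T R) (f : T -> R) (M : R) :
  measurable_fun setT f -> (forall x, `|f x| <= M) ->
  P.-integrable setT (EFin \o f).
Proof.
move=> mf fM; apply: measurable_bounded_integrable => //.
  by rewrite [ltLHS]probability_setT ltry.
exists M; split; first exact: num_real.
by move=> y My x _; exact: le_trans (fM x) (ltW My).
Qed.

Lemma probability_mean_cst (R : realType) (d : measure_display)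
    (T : measurableType d) (P : probability T R) (c : R) :
  \int[P]_(_ in setT) c = c.
Proof. by rewrite Rintegral_cst// [X in fine X]probability_setT mulr1. Qed.

Lemma continuous_borel_integrable (R : realType) (X : ptopologicalType)
    (alpha : borel_prob R X) (f : X -> R) :
  compact [set: X] -> continuous f -> alpha.-integrable setT (EFin \o f).
Proof.
move=> cX cf; have [M fM] := @continuous_compact_bounded R X f cX cf.
apply: (@bounded_probability_integrable _ _ _ _ _ M) => //.
exact: continuous_borel_measurable.
Qed.

Lemma le_mean_continuous (R : realType) (X : ptopologicalType)
    (alpha : borel_prob R X) (f g : X -> R) :
  compact [set: X] -> continuous f -> continuous g ->
  (forall a, f a <= g a) -> \int[alpha]_a f a <= \int[alpha]_a g a.
Proof.
move=> cX cf cg fg.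
by apply: le_Rintegral => //; exact: continuous_borel_integrable.
Qed.

Lemma mean_cst (R : realType) (X : ptopologicalType) (alpha : borel_prob R X)
    (c : R) : \int[alpha]_(_ in setT) c = c.
Proof. exact: probability_mean_cst. Qed.

Lemma meanD (R : realType) (X : ptopologicalType) (alpha : borel_prob R X)
    (f g : X -> R) : compact [set: X] -> continuous f -> continuous g ->
  \int[alpha]_a (f a + g a) = \int[alpha]_a f a + \int[alpha]_a g a.
Proof.
by move=> cX cf cg; rewrite RintegralD//; exact: continuous_borel_integrable.
Qed.

Lemma mean_near (R : realType) (X : ptopologicalType)
    (alpha : borel_prob R X) (f g : X -> R) (e : R) :
  compact [set: X] -> continuous f -> continuous g ->
  (forall a, `|f a - g a| <= e) ->
  `|\int[alpha]_a f a - \int[alpha]_a g a| <= e.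
Proof.
move=> cX cf cg fge.
have mean_shift (h : X -> R) : continuous h ->
    \int[alpha]_a (h a + e) = \int[alpha]_a h a + e.
  by move=> ch; rewrite meanD ?mean_cst// => a; exact: cvg_cst.
have continuous_shift (h : X -> R) :
    continuous h -> continuous (fun a => h a + e).
  by move=> ch a; apply: (continuousD (ch a)); exact: cvg_cst.
rewrite ler_norml; apply/andP; split.
  rewrite lerBrDr addrC -lerBrDr opprK -mean_shift//.
  apply: le_mean_continuous => //; first exact: continuous_shift.
  by move=> a; have := fge a; rewrite ler_norml => /andP[? ?]; lra.
rewrite lerBlDr addrC -mean_shift//.
apply: le_mean_continuous => //; first exact: continuous_shift.
by move=> a; have := fge a; rewrite ler_norml => /andP[? ?]; lra.
Qed.

Lemma meanZ (R : realType) (X : ptopologicalType) (alpha : borel_prob R X)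
    (f : X -> R) (c : R) : compact [set: X] -> continuous f ->
  \int[alpha]_a (f a * c) = \int[alpha]_a f a * c.
Proof.
by move=> cX cf; rewrite RintegralZr//; exact: continuous_borel_integrable.
Qed.

Section mixed_mean.
Variables (R : realType) (X Y : ptopologicalType).
Hypotheses (cX : compact [set: X]) (cY : compact [set: Y]).
Variables (alpha : borel_prob R X) (beta : borel_prob R Y).
Implicit Types f g : X -> Y -> R.
Definition continuous2 f := continuous (fun ab : X * Y => f ab.1 ab.2).

Lemma continuous2_fst f b : continuous2 f -> continuous (f^~ b).
Proof.
move=> cf a; apply: (@continuous_comp _ _ _ (fun a => (a, b))
  (fun ab : X * Y => f ab.1 ab.2)); last exact: cf.
by apply: cvg_pair; [exact: cvg_id|exact: cvg_cst].
Qed.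

(** Since X is compact, f(., b) converges uniformly to f(., b0) as b tends to
    b0, and a mean moves by at most the uniform distance. *)
Lemma continuous_inner_mean f :
  continuous2 f -> continuous (fun b => \int[alpha]_a f a b).
Proof.
move=> cf b0; apply/cvgrPdist_le => e e0.
have near_b0 : \forall b \near b0,
    [set: X] `<=` fun a => `|f a b0 - f a b| <= e.
  move/compact_near_coveringP : cX; apply => a _.
  (* Both f(a', b0) and f(a', b') are within e / 2 of f(a, b0). *)
  have := cf (a, b0) => /cvgrPdist_le/(_ (e / 2)).
  rewrite divr_gt0// => /(_ isT) /= [[U V] /= [nU nV] UV].
  exists (U, V) => //= -[a' b'] /= [Ua' Vb'].
  have /= := UV (a', b') (conj Ua' Vb').
  have /= := UV (a', b0) (conj Ua' (nbhs_singleton nV)).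
  rewrite !ler_norml => /andP[? ?] /andP[? ?]; apply/andP; split; lra.
near=> b; apply: mean_near => //.
- exact: continuous2_fst.
- exact: continuous2_fst.
- by move=> a; exact: (near near_b0 b).
Unshelve. all: end_near. Qed.

Lemma continuous2_cst c : continuous2 (fun _ _ => c).
Proof. by move=> ?; exact: cvg_cst. Qed.

Lemma continuous2D f g :
  continuous2 f -> continuous2 g -> continuous2 (fun a b => f a b + g a b).
Proof. by move=> cf cg ab; apply: cvgD; [exact: cf|exact: cg]. Qed.

Lemma continuous2Z f c :
  continuous2 f -> continuous2 (fun a b => f a b * c).
Proof. by move=> cf ab; apply: cvgM; [exact: cf|exact: cvg_cst]. Qed.

Lemma continuous2_sum (I : Type) (s : seq I) (F : I -> X -> Y -> R) :
  (forall i, continuous2 (F i)) ->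
  continuous2 (fun a b => \sum_(i <- s) F i a b).
Proof.
move=> cF; elim: s => [|i s IHs].
  rewrite (_ : (fun a b => _) = fun _ _ => 0); first exact: continuous2_cst.
  by apply/funext => a; apply/funext => b; rewrite big_nil.
rewrite (_ : (fun a b => _) =
    fun a b => F i a b + \sum_(j <- s) F j a b); first exact: continuous2D.
by apply/funext => a; apply/funext => b; rewrite big_cons.
Qed.

Lemma mixed_mean_cst c : mixed_mean alpha beta (fun _ _ => c) = c.
Proof. by rewrite /mixed_mean !mean_cst. Qed.

Lemma mixed_meanD f g : continuous2 f -> continuous2 g ->
  mixed_mean alpha beta (fun a b => f a b + g a b) =
  mixed_mean alpha beta f + mixed_mean alpha beta g.
Proof.
move=> cf cg; rewrite /mixed_mean -meanD//; try exact: continuous_inner_mean.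
by apply: eq_Rintegral => b _; rewrite meanD//; exact: continuous2_fst.
Qed.

Lemma mixed_meanZ f c : continuous2 f ->
  mixed_mean alpha beta (fun a b => f a b * c) = mixed_mean alpha beta f * c.
Proof.
move=> cf; rewrite /mixed_mean -meanZ//; last exact: continuous_inner_mean.
by apply: eq_Rintegral => b _; rewrite meanZ//; exact: continuous2_fst.
Qed.

Lemma mixed_mean_sum (I : Type) (s : seq I) (F : I -> X -> Y -> R) :
  (forall i, continuous2 (F i)) ->
  mixed_mean alpha beta (fun a b => \sum_(i <- s) F i a b) =
  \sum_(i <- s) mixed_mean alpha beta (F i).
Proof.
move=> cF; elim: s => [|i s IHs].
  rewrite big_nil -[RHS]mixed_mean_cst; congr mixed_mean.
  by apply/funext => a; apply/funext => b; rewrite big_nil.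
rewrite big_cons -IHs -mixed_meanD//; last exact: continuous2_sum.
congr mixed_mean.
by apply/funext => a; apply/funext => b; rewrite big_cons.
Qed.

Lemma le_mixed_mean f g : continuous2 f -> continuous2 g ->
  (forall a b, f a b <= g a b) ->
  mixed_mean alpha beta f <= mixed_mean alpha beta g.
Proof.
move=> cf cg fg; apply: le_mean_continuous => //.
- exact: continuous_inner_mean.
- exact: continuous_inner_mean.
- by move=> b; apply: le_mean_continuous => //; exact: continuous2_fst.
Qed.

Lemma continuous2_max f : continuous2 f ->
  exists a b, forall a' b', f a' b' <= f a b.
Proof.
move=> cf.
have [|||ab _ abmax] := @compact_EVT_max _ R (fun ab : X * Y => f ab.1 ab.2)
    [set: X * Y].
- by exists (point, point).
- by rewrite -setXTT; exact: compact_setX.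
- exact/continuous_subspaceT.
- by exists ab.1, ab.2 => a' b'; apply: (abmax (a', b')); rewrite inE.
Qed.

Lemma continuous2_bounded f : continuous2 f ->
  exists C, forall a b, `|f a b| <= C.
Proof.
move=> cf.
have cXY : compact [set: X * Y] by rewrite -setXTT; exact: compact_setX.
have [C fC] := @continuous_compact_bounded R _ _ cXY cf.
by exists C => a b; exact: (fC (a, b)).
Qed.

End mixed_mean.

(** * Comparison of inf-sup values *)

(** The common bound C makes every supremum and infimum involved a genuine one:
    for unbounded or empty sets these are conventional values, on which
    monotonicity fails. *)
Lemma infsup_le (R : realType) (A B : Type) (a0 : A) (b0 : B)
    (h1 h2 : A -> B -> R) (M C : R) :
  (forall a b, `|h1 a b| <= C) -> (forall a b, `|h2 a b| <= C) ->
  (forall a b, h1 a b <= h2 a b + M) ->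
  inf (range (fun a => sup (range (h1 a)))) <=
  inf (range (fun a => sup (range (h2 a)))) + M.
Proof.
move=> h1C h2C h12.
have ub h a : (forall a b, `|h a b| <= C) -> has_ubound (range (h a)).
  by move=> hC; exists C => _ [b _ <-]; exact: le_trans (ler_norm _) (hC a b).
rewrite -lerBlDr; apply: lb_le_inf; first by exists (sup (range (h2 a0))), a0.
move=> _ [a _ <-]; rewrite lerBlDr.
apply: (@le_trans _ _ (sup (range (h1 a)))).
  apply: ge_inf; last by exists a.
  exists (- C) => _ [a' _ <-].
  apply: (@le_trans _ _ (h1 a' b0)).
    by have := h1C a' b0; rewrite ler_norml => /andP[].
  by apply: ub_le_sup; [exact: ub|exists b0].
apply: ge_sup; first by exists (h1 a b0), b0.
move=> _ [b _ <-]; apply: le_trans (h12 a b) _; rewrite lerD2r.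
by apply: ub_le_sup; [exact: ub|exists b].
Qed.

(** The pure action x as a mixed one; it supplies the inhabitants required by
    [infsup_le]. *)
Definition dirac_borel (R : realType) (X : ptopologicalType) (x : X) :
  borel_prob R X :=
  let y : g_sigma_algebraType (@open X) := x in \d_y.

(** * One step of the Shapley operator against pure actions *)

Section game.
Variables (R : realType) (n : nat) (G : concurrent_game R n).
Implicit Types (x y v z : 'cV[R]_n) (i : 'I_n).

Definition stage_value v i (a : act_min G i) (b : act_max G i) : R :=
  payment a b + \sum_j transition a b j * v j ord0.

Definition pure_drift z i (a : act_min G i) (b : act_max G i) : R :=
  \sum_j transition a b j * z j ord0.

Lemma pure_drift_continuous z i : continuous2 (@pure_drift z i).
Proof.
apply: (@continuous2_sum _ _ _ _ _ (fun j (a : act_min G i)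
  (b : act_max G i) => transition a b j * z j ord0)) => j.
by apply: continuous2Z; exact: (@transition_continuous _ _ G i j).
Qed.

Lemma stage_value_continuous v i : continuous2 (@stage_value v i).
Proof.
apply: continuous2D; first exact: (@payment_continuous _ _ G i).
exact: pure_drift_continuous.
Qed.

(** By linearity of [mixed_mean], the value inside the inf-sup is the mean of a
    single continuous payoff, to which monotonicity applies. *)
Lemma shapleyE v i : shapley G v i ord0 =
  inf (range (fun alpha : borel_prob R (act_min G i) =>
    sup (range (fun beta : borel_prob R (act_max G i) =>
      mixed_mean alpha beta (@stage_value v i))))).
Proof.
rewrite mxE; congr inf; apply: eq_imagel => alpha _.
congr sup; apply: eq_imagel => beta _.
have cA := @act_min_compact _ _ G i; have cB := @act_max_compact _ _ G i.
have cP j := @transition_continuous _ _ G i j.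
rewrite mixed_meanD//.
- congr (_ + _).
  rewrite mixed_mean_sum//; last by move=> j; apply: continuous2Z; exact: cP.
  by apply: eq_bigr => j _; rewrite mixed_meanZ//; exact: cP.
- exact: (@payment_continuous _ _ G i).
- exact: pure_drift_continuous.
Qed.

(** The stage payoffs at x and y differ by the drift of x - y, which is at most
    its maximum over pure actions; means and inf-sups preserve this
    inequality. *)
Lemma shapley_le_pure x y i : exists a b,
  shapley G x i ord0 <= shapley G y i ord0 + @pure_drift (x - y) i a b.
Proof.
have cA := @act_min_compact _ _ G i; have cB := @act_max_compact _ _ G i.
have [a [b maxab]] := continuous2_max cA cB (@pure_drift_continuous (x - y) i).
exists a, b; rewrite !shapleyE; set M := pure_drift _ _.
have cF v := @stage_value_continuous v i.
have [C1 F1] := continuous2_bounded cA cB (cF x).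
have [C2 F2] := continuous2_bounded cA cB (cF y).
have bnd v C alpha beta : (forall a b, `|@stage_value v i a b| <= C) ->
    `|mixed_mean alpha beta (@stage_value v i)| <= C.
  move=> FC; rewrite ler_norml; apply/andP; split.
    rewrite -[leLHS](mixed_mean_cst alpha beta).
    apply: le_mixed_mean => // [|a' b']; first exact: continuous2_cst.
    by have := FC a' b'; rewrite ler_norml => /andP[].
  rewrite -[leRHS](mixed_mean_cst alpha beta).
  apply: le_mixed_mean => // [|a' b']; first exact: continuous2_cst.
  exact: le_trans (ler_norm _) (FC a' b').
apply: (@infsup_le _ _ _ (dirac_borel _ point) (dirac_borel _ point)
  _ _ _ (Num.max C1 C2)).
- by move=> alpha beta; apply: bnd => ? ?; rewrite le_max F1.
- by move=> alpha beta; apply: bnd => ? ?; rewrite le_max F2 orbT.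
move=> alpha beta.
rewrite -[X in _ + X](mixed_mean_cst alpha beta) -mixed_meanD//;
  last exact: continuous2_cst.
apply: le_mixed_mean => //.
  by apply: continuous2D => //; exact: continuous2_cst.
move=> a' b'; rewrite /stage_value -addrA lerD2l.
apply: (@le_trans _ _ (\sum_j transition a' b' j * y j ord0
  + pure_drift (x - y) a' b')).
  rewrite /pure_drift -big_split/= ler_sum// => j _.
  by rewrite !mxE mulrBr addrC subrK.
by rewrite lerD2l.
Qed.

End game.

(** * Iterates against products of pure transition matrices *)

Lemma sub_mxE (R : realType) m n (A B : 'M[R]_(m, n)) i j :
  (A - B) i j = A i j - B i j.
Proof. by rewrite !mxE. Qed.

Section policies.
Variables (R : realType) (n : nat) (G : concurrent_game R n).
Implicit Types (x y z : 'cV[R]_n) (u : 'rV[R]_n).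

(** The rows of a pure policy pair can be chosen independently, so at each state
    one takes a pair of actions bounding T x - T y from above where the weight
    u_i is nonnegative, and from below where it is negative. *)
Lemma shapley_le_policy u x y :
  exists st : policy_min G * policy_max G,
    (u *m (shapley G x - shapley G y)) 0 0
    <= (u *m transition_mx st.1 st.2 *m (x - y)) 0 0.
Proof.
have pure_bound i : exists ab : act_min G i * act_max G i,
    u 0 i * (shapley G x - shapley G y) i 0
    <= u 0 i * pure_drift (x - y) ab.1 ab.2.
  rewrite sub_mxE.
  have [u0|/ltW u0] := leP 0 (u 0 i).
    have [a [b ab]] := @shapley_le_pure _ _ G x y i.
    by exists (a, b); rewrite ler_wpM2l// lerBlDl.
  have [a [b ab]] := @shapley_le_pure _ _ G y x i.
  exists (a, b); rewrite ler_wnM2l//= -lerN2 opprB lerBlDl.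
  apply: le_trans ab _; rewrite lerD2l -sumrN ler_sum// => j _.
  by rewrite -mulrN !sub_mxE opprB.
exists (fun i => (sval (cid (pure_bound i))).1,
        fun i => (sval (cid (pure_bound i))).2).
rewrite -mulmxA [leLHS]mxE [leRHS]mxE; apply: ler_sum => i _.
rewrite [leRHS](_ : _ = u 0 i * pure_drift (x - y)
  (sval (cid (pure_bound i))).1 (sval (cid (pure_bound i))).2);
  first exact: (svalP (cid (pure_bound i))).
by rewrite mxE; congr (_ * _); apply: eq_bigr => j _; rewrite mxE.
Qed.

Lemma km_le_policy (theta : R) u x y : theta <= 1 ->
  exists st : policy_min G * policy_max G,
    (u *m (km_operator theta (shapley G) x - km_operator theta (shapley G) y))
      0 0
    <= (u *m lazy_mx theta st *m (x - y)) 0 0.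
Proof.
move=> theta1; have [st st_le] := shapley_le_policy u x y; exists st.
rewrite /km_operator opprD addrACA -!scalerBr mulmxDr -!scalemxAr.
rewrite (_ : u *m lazy_mx theta st *m (x - y) = theta *: (u *m (x - y))
    + (1 - theta) *: (u *m transition_mx st.1 st.2 *m (x - y))); last first.
  rewrite /lazy_mx (mulmxDr u) mulmxDl -scalemxAr -scalemxAl.
  by rewrite mul_mx_scalar -scalemxAl.
rewrite [leLHS]mxE [leRHS]mxE lerD2l [leLHS]mxE [leRHS]mxE.
by rewrite ler_wpM2l// subr_ge0.
Qed.

(** Peeling the outermost step turns the weight u into u Q, to which the
    induction hypothesis applies; this is why u must be arbitrary, and why the
    first matrix of the product belongs to the last iteration. *)
Lemma iter_km_le_lazy_prod (theta : R) k u x y : theta <= 1 ->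
  exists s : 'I_k -> policy_min G * policy_max G,
    (u *m (iter k (km_operator theta (shapley G)) x
           - iter k (km_operator theta (shapley G)) y)) 0 0
    <= (u *m lazy_prod theta s *m (x - y)) 0 0.
Proof.
move=> theta1; elim: k u => [|k IHk] u.
  exists (fun=> (fun=> point, fun=> point)).
  by rewrite /lazy_prod big_ord0 mulmx1.
rewrite !iterS.
have [st st_le] := km_le_policy u (iter k (km_operator theta (shapley G)) x)
  (iter k (km_operator theta (shapley G)) y) theta1.
have [s s_le] := IHk (u *m lazy_mx theta st).
exists (fun l => if unlift ord0 l is Some l' then s l' else st).
apply: le_trans st_le _; apply: le_trans s_le _.
rewrite /lazy_prod big_ord_recl unlift_none !mulmxA.
by under [in leRHS]eq_bigr do rewrite liftK.
Qed.

End policies.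

(** * Positive entries of lazy products *)

Section lazy_prod.
Variables (R : realType) (n : nat) (G : concurrent_game R n) (theta : R).
Hypotheses (theta_gt0 : 0 < theta) (theta_lt1 : theta < 1).
Hypothesis offdiag_ge : forall p, offdiag_probs G p -> theta <= (1 - theta) * p.

Lemma lazy_mx_ge0 (st : policy_min G * policy_max G) i j :
  0 <= lazy_mx theta st i j.
Proof.
rewrite !mxE addr_ge0//; first by rewrite mulrn_wge0// ltW.
by rewrite mulr_ge0 ?transition_ge0// subr_ge0 ltW.
Qed.

Lemma lazy_mx_sum1 (st : policy_min G * policy_max G) i :
  \sum_j lazy_mx theta st i j = 1.
Proof.
under eq_bigr do rewrite !mxE.
rewrite big_split/= -mulr_sumr transition_sum1 mulr1.
rewrite (bigD1 i)//= eqxx big1 ?addr0; first by rewrite mulr1n addrC subrK.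
by move=> j; rewrite eq_sym => /negPf ->.
Qed.

(** On the diagonal the lazy part contributes theta; off the diagonal only the
    transition contributes. *)
Lemma lazy_mx_gt0 (st : policy_min G * policy_max G) i j :
  0 < lazy_mx theta st i j -> theta <= lazy_mx theta st i j.
Proof.
have th1 : 0 < 1 - theta by rewrite subr_gt0.
rewrite !mxE; have [->|ij] := eqVneq i j.
  by move=> _; rewrite mulr1n lerDl mulr_ge0 ?transition_ge0// ltW.
rewrite mulr0n add0r pmulr_rgt0// => Pij.
by apply: offdiag_ge; exists i, j, (st.1 i), (st.2 i).
Qed.

Lemma lazy_prodS k (s : 'I_k.+1 -> policy_min G * policy_max G) :
  lazy_prod theta s =
  lazy_mx theta (s ord0) *m lazy_prod theta (fun l => s (lift ord0 l)).
Proof. by rewrite /lazy_prod big_ord_recl. Qed.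

Lemma lazy_prod_ge0 k (s : 'I_k -> policy_min G * policy_max G) i j :
  0 <= lazy_prod theta s i j.
Proof.
elim: k s i => [|k IHk] s i; first by rewrite /lazy_prod big_ord0 mxE ler0n.
by rewrite lazy_prodS mxE sumr_ge0// => l _; rewrite mulr_ge0 ?lazy_mx_ge0.
Qed.

Lemma lazy_prod_sum1 k (s : 'I_k -> policy_min G * policy_max G) i :
  \sum_j lazy_prod theta s i j = 1.
Proof.
elim: k s i => [|k IHk] s i.
  rewrite /lazy_prod big_ord0 (bigD1 i)//= big1 ?mxE ?eqxx ?addr0// => j.
  by rewrite mxE eq_sym => /negPf ->.
under eq_bigr do rewrite lazy_prodS mxE.
rewrite exchange_big/=; under eq_bigr do rewrite -mulr_sumr IHk mulr1.
exact: lazy_mx_sum1.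
Qed.

(** A positive entry of a product contains a positive path, whose weight is a
    product of k positive entries. *)
Lemma lazy_prod_gt0 k (s : 'I_k -> policy_min G * policy_max G) i j :
  0 < lazy_prod theta s i j -> theta ^+ k <= lazy_prod theta s i j.
Proof.
elim: k s i => [|k IHk] s i.
  by rewrite /lazy_prod big_ord0 mxE; case: (i == j); rewrite ?ltxx.
rewrite lazy_prodS mxE => prod_gt0.
have term_ge0 l : 0 <= lazy_mx theta (s ord0) i l
    * lazy_prod theta (fun l => s (lift ord0 l)) l j.
  by rewrite mulr_ge0 ?lazy_mx_ge0 ?lazy_prod_ge0.
have [|no_term] := pselect (exists l, 0 < lazy_mx theta (s ord0) i l
    * lazy_prod theta (fun l => s (lift ord0 l)) l j); last first.
  move: prod_gt0; rewrite big1 ?ltxx// => l _; apply/eqP.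
  by rewrite -[_ == _]negbK; apply/negP => ne0; apply: no_term;
     exists l; rewrite lt0r ne0 term_ge0.
move=> [l term_gt0].
have il : 0 < lazy_mx theta (s ord0) i l.
  rewrite lt0r lazy_mx_ge0 andbT; apply: contraTneq term_gt0 => ->.
  by rewrite mul0r ltxx.
move: (term_gt0); rewrite pmulr_rgt0// => lj.
rewrite (bigD1 l)//= exprS; apply: ler_wpDr; first exact: sumr_ge0.
by rewrite ler_pM ?exprn_ge0 ?(ltW theta_gt0) ?lazy_mx_gt0 ?IHk.
Qed.

End lazy_prod.

(** * Contraction in Hilbert's seminorm *)

(** The common part c cancels in the difference; what is left of p and of q has
    mass 1 - sum c and sees values of z between m and M. *)
Lemma doeblin_bound (R : realType) (n : nat) (p q c z : 'I_n -> R) (m M : R) :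
  \sum_j p j = 1 -> \sum_j q j = 1 ->
  (forall j, c j <= p j) -> (forall j, c j <= q j) ->
  (forall j, m <= z j) -> (forall j, z j <= M) ->
  \sum_j p j * z j - \sum_j q j * z j <= (1 - \sum_j c j) * (M - m).
Proof.
move=> p1 q1 cp cq mz zM.
have pM : \sum_j (p j - c j) * z j <= (1 - \sum_j c j) * M.
  rewrite -p1 -sumrB mulr_suml ler_sum// => j _.
  by rewrite ler_wpM2l// subr_ge0.
have qm : (1 - \sum_j c j) * m <= \sum_j (q j - c j) * z j.
  rewrite -q1 -sumrB mulr_suml ler_sum// => j _.
  by rewrite ler_wpM2l// subr_ge0.
rewrite (_ : _ - _ = \sum_j (p j - c j) * z j - \sum_j (q j - c j) * z j).
  by rewrite mulrBr lerB.
by rewrite -!sumrB; apply: eq_bigr => j _; ring.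
Qed.

Section hilbert.
Variables (R : realType) (n : nat).
Implicit Types z : 'cV[R]_n.

Lemma hilbert_seminorm_bounds z i :
  inf (range (fun i => z i ord0)) <= z i ord0
    <= sup (range (fun i => z i ord0)).
Proof.
have z_le j : `|z j ord0| <= \big[Num.max/0]_j `|z j ord0| by exact: le_bigmax.
apply/andP; split.
  apply: ge_inf; last by exists i.
  exists (- \big[Num.max/0]_j `|z j ord0|) => _ [j _ <-].
  by have := z_le j; rewrite ler_norml => /andP[].
apply: ub_le_sup; last by exists i.
exists (\big[Num.max/0]_j `|z j ord0|) => _ [j _ <-].
exact: le_trans (ler_norm _) (z_le j).
Qed.

Lemma hilbert_seminorm_le z (C : R) : (0 < n)%N ->
  (forall i1 i2, z i1 ord0 - z i2 ord0 <= C) -> hilbert_seminorm z <= C.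
Proof.
move=> n0 zC; rewrite /hilbert_seminorm lerBlDr.
apply: ge_sup; first by exists (z (Ordinal n0) ord0), (Ordinal n0).
move=> _ [i1 _ <-]; rewrite -lerBlDl.
apply: lb_le_inf; first by exists (z (Ordinal n0) ord0), (Ordinal n0).
by move=> _ [i2 _ <-]; rewrite lerBlDl -lerBlDr.
Qed.

End hilbert.

(** The overlap gamma is measured by an arbitrary common minorant c of the two
    rows, so that one statement serves both indices: c is concentrated on one
    column for the first and constant for the second. *)
Lemma km_contraction (R : realType) (n : nat) (G : concurrent_game R n)
    (theta : R) (k : nat) (gamma : R) :
  let Ttheta := km_operator theta (shapley G) in
  (0 < n)%N -> 0 < theta -> theta < 1 ->
  (forall (s : 'I_k -> policy_min G * policy_max G) i1 i2,
     exists2 c : 'I_n -> R, \sum_j c j = gamma &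
       forall j, c j <= lazy_prod theta s i1 j
              /\ c j <= lazy_prod theta s i2 j) ->
  forall x y : 'cV[R]_n,
    hilbert_seminorm (iter k Ttheta x - iter k Ttheta y)
    <= (1 - gamma) * hilbert_seminorm (x - y).
Proof.
move=> Ttheta n0 theta_gt0 theta_lt1 overlap x y.
apply: hilbert_seminorm_le => // i1 i2.
(* The difference of two basis rows extracts the difference of two entries. *)
have [s] := @iter_km_le_lazy_prod _ _ G theta k (delta_mx 0 i1 - delta_mx 0 i2)
  x y (ltW theta_lt1).
rewrite -/Ttheta !mulmxBl -!rowE 2!sub_mxE => s_le.
rewrite [row i1 _ _ _]mxE [row i2 _ _ _]mxE in s_le.
apply: le_trans s_le _; rewrite [X in X - _]mxE [X in _ - X]mxE.
have [c <- c_le] := overlap s i1 i2.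
under eq_bigr do rewrite mxE.
under [X in _ - X]eq_bigr do rewrite mxE.
apply: (@doeblin_bound _ _ _ _ c (fun j => (x - y) j ord0)).
- exact: lazy_prod_sum1.
- exact: lazy_prod_sum1.
- by move=> j; have [] := c_le j.
- by move=> j; have [] := c_le j.
- by move=> j; have /andP[] := hilbert_seminorm_bounds (x - y) j.
- by move=> j; have /andP[] := hilbert_seminorm_bounds (x - y) j.
Qed.

(** The value of theta is the one for which the lazy part theta and the smallest
    off-diagonal contribution (1 - theta) p coincide. *)
Lemma laziness_spec (R : realType) (p : R) : 0 < p ->
  let theta := p / (1 + p) in
  [/\ 0 < theta, theta < 1 & (1 - theta) * p = theta].
Proof.
move=> p0 theta; have p1 : 0 < 1 + p by rewrite addr_gt0.
split; first by rewrite divr_gt0.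
  by rewrite ltr_pdivrMr// mul1r ltrDr.
by rewrite /theta; field; rewrite gt_eqF.
Qed.

Unset Implicit Arguments.

Theorem theorem19 (R : realType) (n : nat) (G : concurrent_game R n)
    (pmin : R) (kuni : nat) :
  let theta := pmin / (1 + pmin) in
  let Ttheta := km_operator theta (shapley G) in
  unichain_game G ->
  is_minimum (offdiag_probs G) pmin ->
  is_unichain_index G theta kuni ->
  (forall x y : 'cV[R]_n,
     hilbert_seminorm (iter kuni Ttheta x - iter kuni Ttheta y)
     <= (1 - theta ^+ kuni) * hilbert_seminorm (x - y)) /\
  (irreducible_game G ->
   forall kirr : nat, is_irreducibility_index G theta kirr ->
   forall x y : 'cV[R]_n,
     hilbert_seminorm (iter kirr Ttheta x - iter kirr Ttheta y)
     <= (1 - n%:R * theta ^+ kirr) * hilbert_seminorm (x - y)).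
Proof.
move=> theta Ttheta _ [[i [j [a [b [_ p_gt0 pE]]]]] pmin_lb] [uni _].
rewrite -pE in p_gt0.
have [theta_gt0 theta_lt1 thetaE] := laziness_spec p_gt0.
rewrite -/theta in theta_gt0 theta_lt1 thetaE.
have n0 : (0 < n)%N by exact: leq_ltn_trans (ltn_ord i).
have offdiag_ge p : offdiag_probs G p -> theta <= (1 - theta) * p.
  move=> /pmin_lb pmin_le; rewrite -{1}thetaE.
  by apply: ler_wpM2l => //; rewrite subr_ge0 ltW.
split=> [|_ kirr [irr _]].
  apply: km_contraction => // s i1 i2; have [l [i1l i2l]] := uni i1 i2 s.
  exists (fun m => if m == l then theta ^+ kuni else 0).
    by rewrite -big_mkcond big_pred1_eq.
  by move=> m; have [->|_] := eqVneq m l;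
    rewrite ?lazy_prod_gt0 ?lazy_prod_ge0.
apply: km_contraction => // s i1 i2.
exists (fun=> theta ^+ kirr); first by rewrite sumr_const card_ord mulr_natl.
by move=> l; rewrite !lazy_prod_gt0.
Qed.
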